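(* Let $m\ge1$ be an integer and let $\alpha,\beta$ be non-negative integers with $0\le\alpha+\beta\le m$. There exists a constant $C_{\alpha,\beta}(m)$, depending only on $m,\alpha,\beta$ (in particular independent of $f$ and $\boldsymbol{x}$), such that for every compact convex domain $D\subset\mathbb{R}^2$, all vertices $V_1,V_2,V_3\in D$ of a non-degenerate triangle, every $f\in C^{m,1}(D)$ and every $\boldsymbol{x}\in D$, $$\left|\frac{\partial^{\alpha+\beta}\delta_{m}^{[\Delta_2(V_1,V_2,V_3);V_1]}[f](\boldsymbol{x})}{\partial x^{\alpha}\partial y^{\beta}}\right|\le |f|_{m,1}\,C_{\alpha,\beta}(m)\sum_{l=\max\{1,\alpha+\beta\}}^{m}r^{m+1-l}\left(r^2S\right)^{l}\|\boldsymbol{x}-V_1\|_2^{\,l-(\alpha+\beta)},$$ where $r=\max\{\|V_1-V_2\|_2,\|V_1-V_3\|_2,\|V_2-V_3\|_2\}$ and $S^{-1}=|A(V_1,V_2,V_3)|$.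
   Context: Function classes. $C^m(D)$ is the class of functions of class $C^m$ on $D$ in the sense of Whitney (restrictions to $D$ of $C^m$ functions on $\mathbb{R}^2$). $C^{m,1}(D)$ is the class of $f\in C^m(D)$ whose partial derivatives $\frac{\partial^m f}{\partial x^{m-j}\partial y^j}$, $j=0,\dots,m$, are Lipschitz continuous on $D$, and $$|f|_{m,1}=\sup_{j=0,\dots,m}\ \sup_{\boldsymbol{u}_1\ne\boldsymbol{u}_2\in D}\frac{\left|\frac{\partial^m f}{\partial x^{m-j}\partial y^j}(\boldsymbol{u}_1)-\frac{\partial^m f}{\partial x^{m-j}\partial y^j}(\boldsymbol{u}_2)\right|}{|\boldsymbol{u}_1-\boldsymbol{u}_2|}.$$ Triangle notation. $A(P,Q,R)$ is the determinant of the $3\times3$ matrix whose columns are $(1,P)^T,(1,Q)^T,(1,R)^T$ (so $|A(V_1,V_2,V_3)|$ is twice the area of the triangle). The barycentric coordinates of $\boldsymbol{x}$ are $\lambda_1=\frac{A(\boldsymbol{x},V_2,V_3)}{A(V_1,V_2,V_3)}$, $\lambda_2=\frac{A(V_1,\boldsymbol{x},V_3)}{A(V_1,V_2,V_3)}$, $\lambda_3=\frac{A(V_1,V_2,\boldsymbol{x})}{A(V_1,V_2,V_3)}$. $\Delta_2(V_1,V_2,V_3)$ is the convex hull of $V_1,V_2,V_3$. For $i\ne j$, $D_{ij}f(\boldsymbol{x})=(V_i-V_j)\cdot\nabla f(\boldsymbol{x})$, and for $\beta=(\beta_1,\beta_2)$ with non-negative integer components, $D_1^\beta=D_{21}^{\beta_1}D_{31}^{\beta_2}$,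 $D_2^\beta=D_{12}^{\beta_1}D_{32}^{\beta_2}$, $D_3^\beta=D_{13}^{\beta_1}D_{23}^{\beta_2}$. Bernoulli polynomials. $B_0(x)=1$, $B_n'(x)=nB_{n-1}(x)$ and $\int_0^1B_n(x)\,dx=0$ for $n\ge1$; $B_k=B_k(0)$ and $S_k(x)=B_k(x)-B_k$. The function $\delta_m$ is the polynomial in $\boldsymbol{x}$ (through $\lambda_k=\lambda_k(\boldsymbol{x})$) $$\begin{aligned}\delta_{m}^{[\Delta_2(V_1,V_2,V_3);V_1]}[f](\boldsymbol{x})=&\sum_{j=1}^{m}\int_0^1\frac{D_{31}^{m-j+2}D_1^{(0,j-1)}f(V_1+t(V_3-V_1))(1-t)^{m-j+1}}{(m-j+1)!}\,dt\ \frac{S_j(\lambda_2+\lambda_3)}{j!}\\ &+\sum_{i=1}^{m}\sum_{j=1}^{m-i+1}\Big((-1)^{i+j}\int_0^1\frac{D_{21}^{m-j-i+3}D_2^{(j-1,i-1)}f(V_1+t(V_2-V_1))(1-t)^{m-j-i+2}}{(m-j-i+2)!}\,dt\\ &\qquad+(-1)^{j}\int_0^1\frac{D_{31}^{m-j-i+3}D_3^{(j-1,i-1)}f(V_1+t(V_3-V_1))(1-t)^{m-j-i+2}}{(m-j-i+2)!}\,dt\Big)\\ &\qquad\times\frac{(\lambda_2+\lambda_3)^{i-1}S_i\!\left(\frac{\lambda_2}{\lambda_2+\lambda_3}\right)}{i!}\,\frac{S_j(\lambda_2+\lambda_3)}{j!}.\end{aligned}$$ The products $(\lambda_2+\lambda_3)^{i-1}S_i\left(\frac{\lambda_2}{\lambda_2+\lambda_3}\right)S_j(\lambda_2+\lambda_3)$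 are understood as polynomials in $\lambda_2,\lambda_3$ also where $\lambda_2+\lambda_3=0$. The derivatives of order $m+1$ under the integrals have $D_{21}$ (resp. $D_{31}$) as outermost derivative along the segment of integration; they are the derivatives in $t$ of the Lipschitz functions obtained by restricting the corresponding $m$-th order directional derivatives to that segment, and so are defined for almost every $t\in[0,1]$. Convention: $\|\boldsymbol{x}-V_1\|_2^0=1$. *)

(* Defs.v *)
From HB Require Import structures.
From mathcomp Require Import all_boot all_order all_algebra.
From mathcomp Require Import all_classical all_reals all_analysis.

Set Implicit Arguments.
Unset Strict Implicit.
Unset Printing Implicit Defensive.

Import Order.TTheory GRing.Theory Num.Theory.
Import numFieldNormedType.Exports.

Local Open Scope classical_set_scope.
Local Open Scope ring_scope.

Section Plane.
Context {R : realType}.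
Implicit Types (f F G : 'rV[R]_2 -> R) (D : set 'rV[R]_2).
Implicit Types (u v x P Q T V : 'rV[R]_2).

(* The norm `| u | of the library on 'rV[R]_2 is the max norm. *)
Definition enorm u : R := Num.sqrt (u 0 0 ^+ 2 + u 0 1 ^+ 2).

(* A(P, Q, T): the columns of the matrix are (1, P), (1, Q), (1, T). *)
Definition area P Q T : R :=
  \det (\matrix_(i < 3, j < 3)
          let W := nth 0 [:: P; Q; T] j in [:: 1; W 0 0; W 0 1]`_i).

Definition bary2 V1 V2 V3 x : R := area V1 x V3 / area V1 V2 V3.
Definition bary3 V1 V2 V3 x : R := area V1 V2 x / area V1 V2 V3.

Definition pd (i : 'I_2) f : 'rV[R]_2 -> R := fun u => 'D_(delta_mx 0 i) f u.

(* d^(a+b) f / dx^a dy^b *)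
Definition partial (a b : nat) f : 'rV[R]_2 -> R :=
  iter a (pd 0) (iter b (pd 1) f).

(* v . grad f *)
Definition dird v f : 'rV[R]_2 -> R := fun u => \sum_(i < 2) v 0 i * pd i f u.

(* D_k^(b1, b2), where v and w are the two edges issued from the vertex V_k. *)
Definition dird2 v w (b1 b2 : nat) f : 'rV[R]_2 -> R :=
  iter b1 (dird v) (iter b2 (dird w) f).

Fixpoint is_Cm (m : nat) f : Prop :=
  continuous f /\
  (if m is m'.+1 then
     forall i : 'I_2,
       (forall u, derivable f u (delta_mx 0 i)) /\ is_Cm m' (pd i f)
   else True).

Definition whitney_extension (m : nat) D f F : Prop :=
  is_Cm m F /\ forall u, D u -> F u = f u.

(* Only the values of f on D matter. *)
Definition is_CmD (m : nat) D f : Prop := exists F, whitney_extension m D f F.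

(* The partial derivatives of f \in C^m(D) at the points of D are those of an
   extension. When D is convex and contains a non-degenerate triangle, D is the
   closure of its interior, so they do not depend on the extension. *)
Definition ext (m : nat) D f : 'rV[R]_2 -> R :=
  get [set F | whitney_extension m D f F].

(* Being Lipschitz does not depend on the norm of the plane; the value of the
   seminorm below does. *)
Definition is_Cm1D (m : nat) D f : Prop :=
  is_CmD m D f /\
  forall j : 'I_m.+1, [lipschitz partial (m - j) j (ext m D f) u | u in D].

Definition seminorm_m1 (m : nat) D f : R :=
  \big[Num.max/0]_(j < m.+1)
    sup [set q | exists u1 u2, [/\ D u1, D u2, u1 != u2 &
      q = `|partial (m - j) j (ext m D f) u1 - partial (m - j) j (ext m D f) u2|
            / enorm (u1 - u2)]].

(* \int_0^1 (D_{Q P}^(k+1) G)(P + t (Q - P)) (1 - t)^k / k! dt, where the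
   outermost derivative is that of the restriction of D_{Q P}^k G to the
   segment. It need not exist for all t: [derive1] is then a default value, on
   a negligible set when this restriction is Lipschitz. *)
Definition seg_int P Q (k : nat) G : R :=
  \int[lebesgue_measure]_(t in `[0, 1])
    (derive1 (fun s : R => iter k (dird (Q - P)) G (P + s *: (Q - P))) t
     * (1 - t) ^+ k / k`!%:R).

Definition primitive (p : {poly R}) : {poly R} :=
  \poly_(k < (size p).+1) (p`_k.-1 / k%:R).

Fixpoint bernoulli (n : nat) : {poly R} :=
  if n is n'.+1 then
    let p := primitive (n%:R *: bernoulli n') in
    p - (\int[lebesgue_measure]_(x in `[0, 1]) p.[x])%:P
  else 1.

Definition bernS (n : nat) : {poly R} := bernoulli n - (bernoulli n).[0]%:P.

(* s^(i-1) S_i(a / s) S_j(s) as a polynomial in a and s, obtained as the product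
   of s^i S_i(a / s) and S_j(s) / s; see bernSSE. *)
Definition bernSS (i j : nat) (a s : R) : R :=
  (\sum_(k < i.+1) (bernS i)`_k * a ^+ k * s ^+ (i - k)) * (bernS j %/ 'X).[s].

Definition delta (m : nat) V1 V2 V3 D f x : R :=
  let F := ext m D f in
  let l2 := bary2 V1 V2 V3 x in
  let l3 := bary3 V1 V2 V3 x in
  \sum_(1 <= j < m.+1)
     seg_int V1 V3 (m + 1 - j) (dird2 (V2 - V1) (V3 - V1) 0 (j - 1) F)
     * ((bernS j).[l2 + l3] / j`!%:R)
  + \sum_(1 <= i < m.+1) \sum_(1 <= j < (m - i + 1).+1)
     ((-1) ^+ (i + j)
        * seg_int V1 V2 (m + 2 - (i + j))
            (dird2 (V1 - V2) (V3 - V2) (j - 1) (i - 1) F)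
      + (-1) ^+ j
        * seg_int V1 V3 (m + 2 - (i + j))
            (dird2 (V1 - V3) (V2 - V3) (j - 1) (i - 1) F))
     * (bernSS i j l2 (l2 + l3) / (i`!%:R * j`!%:R)).

Lemma deriv_primitive p : (primitive p)^`() = p.
Proof.
apply/polyP => k; rewrite coef_deriv coef_poly ltnS.
case: ltnP => [lt_k|le_k]; last by rewrite nth_default // mul0rn.
by rewrite -(mulr_natr (_ / _)) divfK // pnatr_eq0.
Qed.

Lemma bernoulli0 : bernoulli 0 = 1.
Proof. by []. Qed.

Lemma deriv_bernoulli n : (bernoulli n.+1)^`() = n.+1%:R *: bernoulli n.
Proof. by rewrite /= derivB derivC subr0 deriv_primitive. Qed.

Lemma size_bernoulli n : (size (bernoulli n) <= n.+1)%N.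
Proof.
elim: n => [|n IHn]; first by rewrite /= size_poly1.
have sz_n : (size (n.+1%:R *: bernoulli n) <= n.+1)%N.
  exact: leq_trans (size_scale_leq _ _) IHn.
rewrite [bernoulli _]/= (leq_trans (size_polyD _ _)) // geq_max size_polyN.
apply/andP; split; first by rewrite (leq_trans (size_poly _ _)).
by rewrite (leq_trans (size_polyC_leq1 _)).
Qed.

Lemma integrable_horner (p : {poly R}) :
  lebesgue_measure.-integrable `[0%R, 1%R] (EFin \o horner p).
Proof.
apply: continuous_compact_integrable; first exact: segment_compact.
apply: continuous_subspaceT => x.
exact/differentiable_continuous/derivable1_diffP/derivable_horner.
Qed.

Lemma int_bernoulli n :
  \int[lebesgue_measure]_(x in `[0, 1]) (bernoulli n.+1).[x] = 0.
Proof.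
set p := primitive (n.+1%:R *: bernoulli n).
set c := \int[lebesgue_measure]_(x in `[0, 1]) p.[x].
under eq_Rintegral => x _ do rewrite /= -/p -/c hornerD hornerN hornerC.
rewrite RintegralB //; last 2 first.
- exact: integrable_horner.
- have := integrable_horner c%:P; congr (_.-integrable _ _).
  by apply/funext => x /=; rewrite hornerC.
have mu01 : lebesgue_measure (`[0, 1]%classic : set R) = 1%E.
  by rewrite lebesgue_measure_itv /= lte01 oppr0 adde0.
by rewrite -/c Rintegral_cst // [X in fine X]mu01 mulr1 subrr.
Qed.

Lemma bernSSE (i j : nat) (a s : R) : (0 < i)%N -> s != 0 ->
  bernSS i j a s = s ^+ (i - 1) * (bernS i).[a / s] * (bernS j).[s].
Proof.
move=> i_gt0 s_neq0.
have size_S : (size (bernS i) <= i.+1)%N.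
  rewrite (leq_trans (size_polyD _ _)) // geq_max size_polyN size_bernoulli.
  by rewrite (leq_trans (size_polyC_leq1 _)).
have XS : 'X %| bernS j.
  rewrite -['X]subr0 -polyC0 dvdp_XsubCl /root /bernS.
  by rewrite hornerD hornerN hornerC subrr.
have -> : (bernS j).[s] = (bernS j %/ 'X).[s] * s.
  by rewrite -[in LHS](divpK XS) hornerM hornerX.
rewrite [_ * s]mulrC mulrA [_ * s]mulrAC -exprSr subn1 prednK //.
rewrite /bernSS (horner_coef_wide _ size_S) mulr_sumr; congr (_ * _).
apply: eq_bigr => k _; have le_ki : (k <= i)%N by rewrite -ltnS.
have -> : s ^+ i = s ^+ (i - k) * s ^+ k by rewrite -exprD subnK.
rewrite expr_div_n [(bernS i)`_k * (_ / _)]mulrA.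
by rewrite [RHS]mulrC [s ^+ (i - k) * _]mulrC mulrA divfK // expf_neq0.
Qed.

End Plane.

(* Main.v *)
Require Import Defs.
From HB Require Import structures.
From mathcomp Require Import all_boot all_order all_algebra.
From mathcomp Require Import all_classical all_reals all_analysis.
From mathcomp Require Import measurable_realfun ring lra zify.

Set Implicit Arguments.
Unset Strict Implicit.
Unset Printing Implicit Defensive.

Import Order.TTheory GRing.Theory Num.Theory.
Import numFieldNormedType.Exports.
Import HBNNSimple.

Local Open Scope classical_set_scope.
Local Open Scope ring_scope.

(** The function [delta m V1 V2 V3 D f] is a polynomial in the two affine
    functions l2 and s = l2 + l3, both of which vanish at V1. Its coefficients
    are rational constants, depending on m only, times segment integrals of
    derivatives of f. The estimate is the product of two independent bounds.

    Size of the integrals ([norm_seg_int_le]). The integrand is the derivative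
    along a segment of a directional derivative of order m in directions of
    length at most r. Mixed partial derivatives commute ([pd_comm]), so this
    directional derivative is a combination of the partial derivatives which
    enter the seminorm, with coefficients of total size at most (2 r)^m
    ([norm_dirds_sub_le]). Its restriction to the segment is therefore Lipschitz
    with constant |f|_{m,1} (2 r)^m r, and this number bounds the integral,
    whose weight (1 - t)^k / k! is at most 1.

    Size of the monomials ([norm_dirds_mono_le]). The affine functions l2 and s
    are linear forms of x - V1 with coefficients bounded by K = r S
    ([bary2E], [bary23E]): they are cross products with an edge of the triangle,
    divided by twice its signed area. A derivative of order n of a monomial of
    degree l in them is thus 0 if l < n, and is at most a constant times
    K^l |x - V1|^(l - n) otherwise. Here 1 <= l <= m: in the term of indices i, j
    the factor coming from S_i is homogeneous of degree i >= 1, the one coming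
    from S_j has degree at most j - 1, and i + j <= m + 1; in the first sum S_j
    has no constant term.

    The product of the two bounds is a constant times
    |f|_{m,1} r^(m+1) (r S)^l |x - V1|^(l - n), and
    r^(m+1) (r S)^l = r^(m+1-l) (r^2 S)^l. *)

(** * Iterated directional derivatives of functions of class C^m *)

Section Calculus.
Context {R : realType}.
Implicit Types (f g F : 'rV[R]_2 -> R) (u v w V : 'rV[R]_2).

Lemma is_Cm_continuous m f : is_Cm m f -> continuous f.
Proof. by case: m => [|m] []. Qed.

Lemma is_Cm_derivable m f i u : is_Cm m.+1 f -> derivable f u (delta_mx 0 i).
Proof. by move=> [_ /(_ i) []]. Qed.

Lemma is_Cm_pd m f i : is_Cm m.+1 f -> is_Cm m (pd i f).
Proof. by move=> [_ /(_ i) []]. Qed.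

Lemma is_Cm_le m n f : (n <= m)%N -> is_Cm m f -> is_Cm n f.
Proof.
elim: n m f => [|n IHn] m f le_nm Cf.
  by split=> //; exact: is_Cm_continuous Cf.
case: m le_nm Cf => // m; rewrite ltnS => le_nm Cf.
split=> [|i]; first exact: is_Cm_continuous Cf.
split=> [u|]; first exact: is_Cm_derivable Cf.
exact: IHn le_nm (is_Cm_pd i Cf).
Qed.

Lemma pd_comb (c d : R) f g i : is_Cm 1 f -> is_Cm 1 g ->
  (forall u, derivable (fun u => c * f u + d * g u) u (delta_mx 0 i)) /\
  pd i (fun u => c * f u + d * g u) = fun u => c * pd i f u + d * pd i g u.
Proof.
move=> Cf Cg; have Dfg u : is_derive u (delta_mx 0 i)
    (fun u => c * f u + d * g u) (c * pd i f u + d * pd i g u).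
  have Df := derivableP (@is_Cm_derivable _ _ i u Cf).
  have Dg := derivableP (@is_Cm_derivable _ _ i u Cg).
  exact: is_deriveD (is_deriveZ c Df) (is_deriveZ d Dg).
split=> [u|]; first exact: ex_derive.
by apply/funext => u; exact: derive_val.
Qed.

Lemma is_Cm_comb m (c d : R) f g :
  is_Cm m f -> is_Cm m g -> is_Cm m (fun u => c * f u + d * g u).
Proof.
elim: m f g => [|m IHm] f g Cf Cg.
  split=> // u; have cM (e : R) h : is_Cm 0 h -> e * h x @[x --> u] --> e * h u.
    by move=> [Ch _]; exact: cvgM (cvg_cst e) (Ch u).
  exact: cvgD (cM c f Cf) (cM d g Cg).
split=> [|i].
  by apply: is_Cm_continuous (IHm _ _ _ _); exact: is_Cm_le (leqnSn m) _.
have [D E] := pd_comb c d i (is_Cm_le (ltn0Sn m) Cf) (is_Cm_le (ltn0Sn m) Cg).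
by split; [exact: D|rewrite E; apply: IHm; exact: is_Cm_pd].
Qed.

Lemma dirdE v f :
  dird v f = fun u => v 0 0 * pd 0 f u + v 0 1 * pd 1 f u.
Proof.
apply/funext => u; rewrite /dird big_ord_recr big_ord1 /=.
by do 2 f_equal; f_equal; apply/val_inj.
Qed.

Lemma is_Cm_dird m v f : is_Cm m.+1 f -> is_Cm m (dird v f).
Proof. by rewrite dirdE => Cf; apply: is_Cm_comb; exact: is_Cm_pd. Qed.

Lemma dird_comb (c d : R) f g v : is_Cm 1 f -> is_Cm 1 g ->
  dird v (fun u => c * f u + d * g u) = fun u => c * dird v f u + d * dird v g u.
Proof.
move=> Cf Cg; rewrite !dirdE !(pd_comb c d _ Cf Cg).2.
apply/funext => u; move: (pd 0 f u) (pd 1 f u) (pd 0 g u) (pd 1 g u) => p q p' q'.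
ring.
Qed.

Definition dirds (ws : seq 'rV[R]_2) f := foldr dird f ws.

Lemma is_Cm_dirds m ws f : is_Cm (size ws + m) f -> is_Cm m (dirds ws f).
Proof.
elim: ws m => //= v ws IH m Cf; apply: is_Cm_dird; apply: IH.
by rewrite addnS.
Qed.

Lemma dirds_comb (c d : R) f g ws : is_Cm (size ws) f -> is_Cm (size ws) g ->
  dirds ws (fun u => c * f u + d * g u) =
  fun u => c * dirds ws f u + d * dirds ws g u.
Proof.
elim: ws => //= v ws IH Cf Cg.
rewrite IH; [|exact: is_Cm_le (leqnSn _) Cf|exact: is_Cm_le (leqnSn _) Cg].
by rewrite dird_comb //; apply: is_Cm_dirds; rewrite addn1.
Qed.

Lemma is_derive_line f u v t :
  derivable f (u + t *: v) v ->
  is_derive t 1 (fun s => f (u + s *: v)) ('D_v f (u + t *: v)).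
Proof.
have E : (fun h : R => h^-1 *: (((fun s => f (u + s *: v)) \o shift t) (h *: 1)
            - f (u + t *: v)))
       = (fun h : R => h^-1 *: ((f \o shift (u + t *: v)) (h *: v)
            - f (u + t *: v))).
  apply/funext => h /=; congr (_ *: (f _ - _)).
  by rewrite [h *: 1]mulr1 scalerDl addrCA.
by move=> Df; split; rewrite /derivable /derive E.
Qed.

Lemma derive_mean_value f df u v (h : R) : 0 < h ->
  (forall x, is_derive x v f (df x)) ->
  exists2 t, 0 < t < h & f (u + h *: v) - f u = h * df (u + t *: v).
Proof.
move=> h_gt0 Df.
have Dl (t : R) :
    is_derive t (1 : R) (fun s : R => f (u + s *: v)) (df (u + t *: v)).
  have := @is_derive_line f u v t (@ex_derive _ _ _ _ _ _ _ (Df _)).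
  by rewrite derive_val.
have [|t t_in] := MVT h_gt0 (fun t _ => Dl t).
  apply: continuous_subspaceT => t.
  by apply/differentiable_continuous/derivable1_diffP; exact: ex_derive.
by rewrite scale0r addr0 subr0 mulrC => E; exists t.
Qed.

Let dist_le_halves (p q a b e : R) :
  `|p - a| < e / 2 -> `|q - b| < e / 2 -> a = b -> `|p - q| <= e.
Proof.
move=> pa qb ab; rewrite (le_trans (ler_distD a _ _)) // (splitr e).
by rewrite lerD ?ltW // ab distrC.
Qed.

(** Schwarz's theorem. Two applications of the mean value theorem identify the
    second difference of f on a square of side h at u with h^2 times a value of
    either mixed derivative near u; both are continuous, so they agree at u. *)
Lemma pd_comm f i j : is_Cm 2 f -> pd i (pd j f) = pd j (pd i f).
Proof.
have Dpd g k : is_Cm 1 g -> forall x, is_derive x (delta_mx 0 k) g (pd k g x).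
  by move=> Cg x; apply: derivableP; exact: is_Cm_derivable Cg.
move=> Cf; pose e k : 'rV[R]_2 := delta_mx 0 k.
have C1 : is_Cm 1 f by exact: is_Cm_le (leqnSn 1) Cf.
(* Differentiating the increment g along [e k] first gives a value of the
   derivative taken along [e l], then along [e k]. *)
have key k l u (h : R) : 0 < h -> exists s t, [/\ 0 < s < h, 0 < t < h &
    f (u + h *: e k + h *: e l) - f (u + h *: e k) - f (u + h *: e l) + f u
    = h * (h * pd k (pd l f) (u + s *: e k + t *: e l))].
  move=> h_gt0.
  pose g x := f (x + h *: e k) - f x.
  pose dg x := pd l f (x + h *: e k) - pd l f x.
  have Dg x : is_derive x (e l) g (dg x).
    apply: is_deriveB; last exact: Dpd.
    have DF := Dpd _ l C1 (x + h *: e k).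
    have E : (fun a : R => a^-1 *:
         (((fun y => f (y + h *: e k)) \o shift x) (a *: e l) - f (x + h *: e k)))
       = (fun a : R => a^-1 *: ((f \o shift (x + h *: e k)) (a *: e l)
            - f (x + h *: e k))).
      by apply/funext => a /=; rewrite addrA.
    split; rewrite /derivable /derive E; last exact: derive_val.
    exact: is_Cm_derivable C1.
  have [t t_in Et] := derive_mean_value u h_gt0 Dg.
  have C2 : is_Cm 1 (pd l f) by exact: is_Cm_pd Cf.
  have [s s_in Es] := derive_mean_value (u + t *: e l) h_gt0 (Dpd _ k C2).
  exists s, t; split=> //.
  rewrite [u + s *: _ + _]addrAC -Es -/(dg (u + t *: e l)) -Et /g.
  by rewrite [u + h *: e l + _]addrAC; ring.
have C2 k l : continuous (pd k (pd l f)).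
  exact: is_Cm_continuous (is_Cm_pd k (is_Cm_pd l Cf)).
apply/funext => u.
apply/eqP; rewrite -subr_eq0 -normr_le0; apply/ler_addgt0Pl => eps eps_gt0.
rewrite addr0.
have eps2 : 0 < eps / 2 by rewrite divr_gt0.
have near_u k l : exists2 d : R, 0 < d & forall s t : R, 0 < s < d -> 0 < t < d ->
    `|pd k (pd l f) u - pd k (pd l f) (u + s *: e k + t *: e l)| < eps / 2.
  have /cvgrPdist_lt /(_ _ eps2) := C2 k l u.
  move=> /nbhs_ballP [d /= d_gt0 dP]; exists (d / 2); first by rewrite divr_gt0.
  move=> s t /andP [s0 sd] /andP [t0 td]; apply: dP.
  rewrite -ball_normE /ball_ /=.
  rewrite -addrA opprD addrA subrr add0r normrN.
  have ne m : `|e m| <= 1.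
    rewrite /Num.norm /= mx_normrE; apply/bigmax_leP; split=> // -[a b] _ /=.
    by rewrite mxE; case: (_ && _); rewrite ?normr1 ?normr0.
  rewrite (le_lt_trans (ler_normD _ _)) // !normrZ.
  rewrite (splitr d) ltrD //.
    by rewrite (le_lt_trans _ sd) // gtr0_norm // ler_piMr // ltW.
  by rewrite (le_lt_trans _ td) // gtr0_norm // ler_piMr // ltW.
have [d1 d1_gt0 d1P] := near_u i j; have [d2 d2_gt0 d2P] := near_u j i.
pose h := Num.min d1 d2.
have h_gt0 : 0 < h by rewrite lt_min d1_gt0.
have [s [t [/andP[s0 sh] /andP[t0 th] E1]]] := key i j u h h_gt0.
have [s' [t' [/andP[s'0 s'h] /andP[t'0 t'h] E2]]] := key j i u h h_gt0.
move: sh th s'h t'h; rewrite !lt_min.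
move=> /andP[sh _] /andP[th _] /andP[_ s'h] /andP[_ t'h].
have B1 := d1P s t; have B2 := d2P s' t'.
rewrite s0 t0 sh th in B1; rewrite s'0 t'0 s'h t'h in B2.
have {}B1 := B1 isT isT; have {}B2 := B2 isT isT.
have E : pd i (pd j f) (u + s *: e i + t *: e j)
       = pd j (pd i f) (u + s' *: e j + t' *: e i).
  have h_neq0 : h != 0 by rewrite gt_eqF.
  apply: (mulfI h_neq0); apply: (mulfI h_neq0).
  apply: (etrans (esym E1)); apply: (etrans _ E2).
  by rewrite [u + h *: e j + h *: e i]addrAC [X in X + _ = _]addrAC.
exact: dist_le_halves B1 B2 E.
Qed.
End Calculus.

(** * Increments and integrals of derivatives *)

Section DerivativeBounds.
Context {R : realType}.
Implicit Types (f g F : 'rV[R]_2 -> R) (u v w V : 'rV[R]_2).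

Lemma pd_iter_pd i j n f : is_Cm n.+1 f ->
  pd i (iter n (pd j) f) = iter n (pd j) (pd i f).
Proof.
elim: n f => // n IHn f Cf; rewrite iterSr IHn; last exact: is_Cm_pd Cf.
by rewrite pd_comm ?iterSr //; exact: is_Cm_le Cf.
Qed.

Lemma is_Cm_iter_pd i n m f : is_Cm (n + m) f -> is_Cm m (iter n (pd i) f).
Proof.
elim: n m => //= n IHn m Cf; apply: is_Cm_pd; apply: IHn.
by rewrite addnS.
Qed.

Lemma is_Cm_partial a b m f : is_Cm (a + b + m) f -> is_Cm m (partial a b f).
Proof.
by move=> Cf; do 2 apply: is_Cm_iter_pd; rewrite addnA [(b + a)%N]addnC.
Qed.

Lemma pd1_partial a b f : is_Cm (a + b).+1 f ->
  pd 1 (partial a b f) = partial a b.+1 f.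
Proof.
move=> Cf; rewrite /partial pd_iter_pd // ?iterS //.
by apply: is_Cm_iter_pd; rewrite addnS addnC.
Qed.

(** The innermost direction v is expanded first, since
    D_v (partial a b F) = v_0 partial (a+1) b F + v_1 partial a (b+1) F keeps the
    shape of the innermost function; hence the induction from the right. Each
    direction costs a factor 2 r. *)
Lemma norm_dirds_sub_le (M r : R) m F u1 u2 :
  is_Cm m F ->
  (forall j, (j <= m)%N ->
     `|partial (m - j) j F u1 - partial (m - j) j F u2| <= M) ->
  forall ws a b, (size ws + a + b)%N = m ->
  (forall v, v \in ws -> forall i, `|v 0 i| <= r) ->
  `|dirds ws (partial a b F) u1 - dirds ws (partial a b F) u2|
    <= (2 * r) ^+ size ws * M.
Proof.
move=> CF FM; elim/last_ind => [|ws v IH] a b.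
  rewrite add0n => /= Em _; rewrite expr0 mul1r.
  by have := FM b; rewrite -{2 3}Em addnK; apply; rewrite -Em leq_addl.
rewrite size_rcons => Em ws_le.
have v_le i : `|v 0 i| <= r by apply: ws_le; rewrite mem_rcons mem_head.
have {}ws_le w : w \in ws -> forall i, `|w 0 i| <= r.
  by move=> w_in; apply: ws_le; rewrite mem_rcons inE w_in orbT.
have r_ge0 : 0 <= r by exact: le_trans (v_le 0).
have Cab : is_Cm (size ws).+1 (partial a b F).
  by apply: is_Cm_partial; apply: is_Cm_le CF; lia.
rewrite /dirds foldr_rcons -!/(dirds _ _) dirdE.
rewrite dirds_comb; last 2 first.
- exact: is_Cm_pd.
- exact: is_Cm_pd.
rewrite pd1_partial; last by apply: is_Cm_le CF; rewrite -Em; lia.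
have B0 := IH a.+1 b; have B1 := IH a b.+1.
rewrite -[pd 0 _]/(partial a.+1 b F).
have {}B0 := B0 ltac:(lia) ws_le.
have {}B1 := B1 ltac:(lia) ws_le.
set p := dirds ws _ u1 in B0 *; set q := dirds ws _ u1 in B1 *.
set p' := dirds ws _ u2 in B0 *; set q' := dirds ws _ u2 in B1 *.
clearbody p q p' q'.
rewrite [X in `|X|](_ : _ = v 0 0 * (p - p') + v 0 1 * (q - q')); last by ring.
rewrite (le_trans (ler_normD _ _)) // !normrM.
pose Z := (2 * r) ^+ size ws * M.
rewrite [X in _ <= X](_ : _ = r * Z + r * Z).
  by rewrite lerD // ler_pM.
by rewrite /Z exprS; ring.
Qed.

(** Where the derivative does not exist, [derive1] takes its default value 0. At
    the endpoints it is already determined by the difference quotients taken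
    inside [0, 1], where the Lipschitz bound is available. *)
Lemma norm_derive1_le (phi : R -> R) (M t : R) :
  0 <= M ->
  (forall s1 s2, 0 <= s1 <= 1 -> 0 <= s2 <= 1 ->
     `|phi s1 - phi s2| <= M * `|s1 - s2|) ->
  0 <= t <= 1 -> `|derive1 phi t| <= M.
Proof.
move=> M_ge0 phiM /andP[t_ge0 t_le1].
have [cv|ncv] :=
  pselect (cvg (h^-1 *: (phi (h + t) - phi t) @[h --> 0^'])); last first.
  by rewrite /derive1 (dvgP ncv) normr0.
apply/ler_addgt0Pl => eps eps_gt0.
have /cvgrPdist_lt /(_ _ eps_gt0) := cv.
move=> /nbhs_ballP [d /= d_gt0 dP].
pose e := Num.min (d / 2) (2^-1).
have e_gt0 : 0 < e by rewrite lt_min divr_gt0 //= invr_gt0.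
have e_ltd : e < d by rewrite gt_min ltr_pdivrMr // ltr_pMr ?ltr1n.
have e_le2 : e <= 2^-1 by rewrite ge_min lexx orbT.
(* The increment points towards the farther end of [0, 1]. *)
have [h [h_lt h_neq0 ht]] : exists h, [/\ `|h| < d, h != 0 & 0 <= h + t <= 1].
  have [t_le2|t_gt2] := leP t 2^-1.
    exists e; rewrite gtr0_norm // gt_eqF //; split=> //.
    by apply/andP; split; lra.
  exists (- e); rewrite normrN gtr0_norm // oppr_eq0 gt_eqF //; split=> //.
  by apply/andP; split; lra.
have := dP h; rewrite -ball_normE /ball_ /= sub0r normrN => /(_ h_lt h_neq0).
rewrite -/(derive1 phi t) => /ltW /(le_trans (lerB_dist _ _)).
rewrite lerBlDr => /le_trans; apply; rewrite lerD2l.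
rewrite normrM normfV ler_pdivrMl ?normr_gt0 // mulrC.
by rewrite (le_trans (phiM _ _ ht _)) ?t_ge0 // addrK.
Qed.

(** The integrand may fail to be measurable, so the bound is read off the
    definition: the integral of a nonnegative function is the supremum of the
    integrals of the simple functions below it, and on [0, 1] each of these is
    below the constant M. *)
Lemma ge0_integral01_le (k : R -> \bar R) (M : R) : 0 <= M ->
  (forall t, 0 <= k t)%E -> (forall t, (0 <= t <= 1)%R -> k t <= M%:E)%E ->
  (\int[lebesgue_measure]_(t in `[0%R, 1%R]) k t <= M%:E)%E.
Proof.
move=> M_ge0 k_ge0 kM.
have mD : measurable (`[0, 1]%classic : set R) by exact: measurable_itv.
have -> : (M%:E = \int[lebesgue_measure]_(t in `[0%R, 1%R]) (cst M%:E) t)%E.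
  rewrite integral_cst //= lebesgue_measure_itv /= lte_fin ltr01.
  by rewrite oppr0 adde0 mule1.
rewrite [leLHS]integral_mkcond ge0_integralTE; last first.
  by move=> t; apply: erestrict_ge0.
apply: ge_ereal_sup => _ /= [h h_le <-].
rewrite -[X in sintegral _ X](patch_setT (fun=> 0)) -integral_nnsfun //.
rewrite [leRHS]integral_mkcond; apply: ge0_le_integral => //.
- by move=> t _; rewrite lee_fin; exact: fun_ge0.
- by apply/measurable_EFinP; exact: measurable_funPT.
- have mc : measurable_fun (`[0, 1]%classic : set (measurableTypeR R))
      (fun=> M%:E : \bar R) by exact: measurable_cst.
  exact: (proj1 (measurable_restrictT _ mD) mc).
- move=> t _; apply: le_trans (h_le t) _; rewrite /patch.
  by case: ifP => // /set_mem; rewrite /= in_itv /=; exact: kM.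
Qed.

Lemma norm_Rintegral01_le (g : R -> R) (M : R) : 0 <= M ->
  (forall t, 0 <= t <= 1 -> `|g t| <= M) ->
  `|\int[lebesgue_measure]_(t in `[0, 1]) g t| <= M.
Proof.
move=> M_ge0 gM; rewrite /Rintegral integralE.
set f := (fun t => (g t)%:E).
have P0 : (0 <= \int[lebesgue_measure]_(t in `[0%R, 1%R]) f^\+ t)%E.
  by apply: integral_ge0 => t _; exact: funepos_ge0.
have N0 : (0 <= \int[lebesgue_measure]_(t in `[0%R, 1%R]) f^\- t)%E.
  by apply: integral_ge0 => t _; exact: funeneg_ge0.
have PM : (\int[lebesgue_measure]_(t in `[0%R, 1%R]) f^\+ t <= M%:E)%E.
  apply: ge0_integral01_le => // t /gM; rewrite ler_norml => /andP[_ gt].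
  by rewrite funeposE ge_max !lee_fin gt.
have NM : (\int[lebesgue_measure]_(t in `[0%R, 1%R]) f^\- t <= M%:E)%E.
  apply: ge0_integral01_le => // t /gM; rewrite ler_norml => /andP[gt _].
  by rewrite funenegE ge_max -EFinN !lee_fin lerNl gt.
move: P0 N0 PM NM; case: (integral _ _ _) => // p; case: (integral _ _ _) => // q.
rewrite -EFinB /= !lee_fin => p0 q0 pM qM.
by rewrite ler_norml; apply/andP; split; lra.
Qed.
End DerivativeBounds.

(** * Segment integrals *)

Section SegmentIntegrals.
Context {R : realType}.
Implicit Types (D : set 'rV[R]_2) (f F : 'rV[R]_2 -> R) (u v P Q : 'rV[R]_2).

Lemma enorm_ge0 u : 0 <= enorm u.
Proof. exact: sqrtr_ge0. Qed.

Lemma ord2_cases (i : 'I_2) : i = 0 \/ i = 1.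
Proof. by case: i => [[|[|//]] ?]; [left|right]; exact/val_inj. Qed.

Lemma norm_coord_le u i : `|u 0 i| <= enorm u.
Proof.
rewrite -sqrtr_sqr /enorm ler_sqrt ?addr_ge0 ?sqr_ge0 //.
by have [->|->] := ord2_cases i; rewrite ?lerDl ?lerDr sqr_ge0.
Qed.

Lemma mxnorm_le_enorm u : `|u| <= enorm u.
Proof.
rewrite /Num.norm /= mx_normrE; apply/bigmax_leP; split; first exact: enorm_ge0.
by move=> [i j] _ /=; rewrite ord1 norm_coord_le.
Qed.

Lemma enorm_gt0 u : u != 0 -> 0 < enorm u.
Proof.
by move=> u_neq0; apply: lt_le_trans (mxnorm_le_enorm u); rewrite normr_gt0.
Qed.

Lemma enormZ (t : R) u : enorm (t *: u) = `|t| * enorm u.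
Proof. by rewrite /enorm !mxE !exprMn -mulrDr sqrtrM ?sqr_ge0 // sqrtr_sqr. Qed.

Lemma enormN u : enorm (- u) = enorm u.
Proof. by rewrite -scaleN1r enormZ normrN normr1 mul1r. Qed.

Lemma ext_Cm m D f : is_CmD m D f -> is_Cm m (ext m D f).
Proof.
by move=> fC; have [] : whitney_extension m D f (ext m D f) by apply: getPex.
Qed.

Lemma seminorm_m1_ge0 m D f : 0 <= seminorm_m1 m D f.
Proof. by rewrite /seminorm_m1; apply: bigmax_ge_id. Qed.

Lemma partial_sub_le m D f j u1 u2 : is_Cm1D m D f -> (j <= m)%N ->
  D u1 -> D u2 ->
  `|partial (m - j) j (ext m D f) u1 - partial (m - j) j (ext m D f) u2|
    <= seminorm_m1 m D f * enorm (u1 - u2).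
Proof.
move=> [_ lip] le_jm Du1 Du2.
have [->|u_neq] := eqVneq u1 u2.
  by rewrite subrr normr0 mulr_ge0 ?seminorm_m1_ge0 ?enorm_ge0.
have u_gt0 : 0 < enorm (u1 - u2) by rewrite enorm_gt0 ?subr_eq0.
rewrite -ler_pdivrMr //.
pose j' : 'I_m.+1 := Ordinal (le_jm : (j < m.+1)%N).
rewrite /seminorm_m1; apply: le_trans (le_bigmax _ _ j') => /=.
have [M [_ MP]] := lip j'.
apply: ub_le_sup; last by exists u1, u2.
exists (`|M| + 1) => _ [v1 [v2 [Dv1 Dv2 v_neq ->]]].
have v_gt0 : 0 < enorm (v1 - v2) by rewrite enorm_gt0 ?subr_eq0.
rewrite ler_pdivrMr //.
have M_lt : M < `|M| + 1 by rewrite (le_lt_trans (ler_norm M)) // ltrDl.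
have := MP _ M_lt (v1, v2) (conj Dv1 Dv2) => /= /le_trans; apply.
by rewrite ler_wpM2l ?mxnorm_le_enorm // addr_ge0.
Qed.

Lemma segment_in D P Q (t : R) : convex_set D -> D P -> D Q -> 0 <= t <= 1 ->
  D (P + t *: (Q - P)).
Proof.
move=> cvD DP DQ /andP[t_ge0 t_le1].
pose s := Itv01 t_ge0 t_le1.
have := cvD Q P s (mem_set DQ) (mem_set DP) => /set_mem.
congr D; rewrite /conv /= /unstable.onem.
by rewrite scalerBr scalerBl scale1r addrC addrA addrAC.
Qed.

Lemma iter_dird k v f : iter k (dird v) f = dirds (nseq k v) f.
Proof. by elim: k => //= k ->. Qed.

Lemma dirds_cat ws1 ws2 f : dirds (ws1 ++ ws2) f = dirds ws1 (dirds ws2 f).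
Proof. exact: foldr_cat. Qed.

(** The factor (1 - t)^k / k! is at most 1. Of the powers of r, m come from the
    directions of the derivatives, and one from the length of the segment. *)
Lemma norm_seg_int_le m D f P Q (r : R) k ws :
  convex_set D -> is_Cm1D m D f -> D P -> D Q -> (k + size ws)%N = m ->
  enorm (Q - P) <= r -> (forall w, w \in ws -> enorm w <= r) ->
  `|seg_int P Q k (dirds ws (ext m D f))|
    <= seminorm_m1 m D f * ((2 * r) ^+ m * r).
Proof.
move=> cvD fC DP DQ Em PQ_le ws_le.
have r_ge0 : 0 <= r := le_trans (enorm_ge0 _) PQ_le.
set N := seminorm_m1 m D f.
have N_ge0 : 0 <= N by exact: seminorm_m1_ge0.
have B_ge0 : 0 <= N * ((2 * r) ^+ m * r) by rewrite !mulr_ge0 ?exprn_ge0 ?mulr_ge0.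
apply: norm_Rintegral01_le => // t /[dup] t01 /andP[t_ge0 t_le1].
rewrite -mulrA normrM -[leRHS]mulr1 ler_pM //.
  apply: (norm_derive1_le B_ge0 _ t01) => s1 s2 s1_01 s2_01.
  rewrite iter_dird -dirds_cat -[ext m D f]/(partial 0 0 (ext m D f)).
  pose M := N * enorm (P + s1 *: (Q - P) - (P + s2 *: (Q - P))).
  apply: (le_trans (@norm_dirds_sub_le _ M r m _ _ _ _ _ _ _ _ _ _)).
  - by apply: ext_Cm; case: fC.
  - by move=> j le_jm; apply: partial_sub_le => //; exact: segment_in.
  - by rewrite size_cat size_nseq !addn0.
  - move=> v; rewrite mem_cat mem_nseq => /orP[/andP[_ /eqP->]|v_in] i.
      exact: le_trans (norm_coord_le _ _) PQ_le.
    exact: le_trans (norm_coord_le _ _) (ws_le _ v_in).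
  rewrite /M size_cat size_nseq Em opprD addrACA subrr add0r -scalerBl enormZ.
  rewrite mulrCA -mulrA ler_wpM2l // -mulrA ler_wpM2l ?exprn_ge0 ?mulr_ge0 //.
  by rewrite [leRHS]mulrC ler_wpM2l.
have t1_ge0 : 0 <= 1 - t by rewrite subr_ge0.
have t1_le1 : 1 - t <= 1 by rewrite lerBlDr lerDl.
rewrite ger0_norm ?divr_ge0 ?exprn_ge0 ?ler0n // ler_pdivrMr ?ltr0n ?fact_gt0 //.
rewrite mul1r (le_trans (exprn_ile1 _ t1_ge0 t1_le1)) // ler1n fact_gt0 //.
Qed.
End SegmentIntegrals.

(** * Derivatives of monomials in two linear forms *)

Section LinearForms.
Context {R : realType}.
Implicit Types (c u v V x : 'rV[R]_2).

Definition lform c v : R := c 0 0 * v 0 0 + c 0 1 * v 0 1.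

Lemma norm_lform_le c v (K L : R) : (forall i, `|c 0 i| <= K) ->
  (forall i, `|v 0 i| <= L) -> `|lform c v| <= 2 * K * L.
Proof.
move=> cK vL; rewrite (le_trans (ler_normD _ _)) // !normrM.
rewrite (_ : 2 * K * L = K * L + K * L); last by ring.
by rewrite lerD // ler_pM.
Qed.

Lemma is_derive_lform c V u v :
  is_derive u v (fun y : 'rV[R]_2 => lform c (y - V)) (lform c v).
Proof.
have C : h^-1 *: (((fun y : 'rV[R]_2 => lform c (y - V)) \o shift u) (h *: v)
            - lform c (u - V)) @[h --> 0^'] --> lform c v.
  apply: cvg_near_cst; near=> h.
  have E : lform c (h *: v + u - V) - lform c (u - V) = h * lform c v.
    by rewrite /lform !mxE; ring.
  have h_neq0 : h != 0 by near: h; exact: nbhs_dnbhs_neq.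
  exact: etrans (congr1 ( *%R h^-1) E) (mulKf h_neq0 _).
by split; [exact: cvgP C|exact: cvg_lim C].
Unshelve. all: by end_near. Qed.

Lemma continuous_lform c V : continuous (fun y : 'rV[R]_2 => lform c (y - V)).
Proof.
have -> : (fun y : 'rV[R]_2 => lform c (y - V)) =
    (fun y => c 0 0 * (y 0 0 - V 0 0) + c 0 1 * (y 0 1 - V 0 1)).
  by apply/funext => y; rewrite /lform !mxE.
move=> u; have cc i : (fun y : 'rV[R]_2 => c 0 i * (y 0 i - V 0 i)) y @[y --> u]
    --> c 0 i * (u 0 i - V 0 i).
  exact: cvgM (cvg_cst _) (cvgB (@coord_continuous _ _ _ 0 i u) (cvg_cst _)).
exact: cvgD (cc 0) (cc 1).
Qed.

Section Monomials.
Variables (ca cb V : 'rV[R]_2).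

Definition mono p q : 'rV[R]_2 -> R :=
  fun u => lform ca (u - V) ^+ p * lform cb (u - V) ^+ q.

Lemma is_derive_mono p q u v :
  is_derive u v (mono p q)
    ((p%:R * lform ca v) * mono p.-1 q u + (q%:R * lform cb v) * mono p q.-1 u).
Proof.
have DA := is_deriveX p (is_derive_lform ca V u v).
have DB := is_deriveX q (is_derive_lform cb V u v).
have -> : mono p q = (fun y : 'rV[R]_2 => lform ca (y - V)) ^+ p
    * (fun y : 'rV[R]_2 => lform cb (y - V)) ^+ q.
  by apply/funext => y; rewrite /mono [RHS]/GRing.mul /= !exprfctE.
apply: (is_derive_eq (is_deriveM DA DB)).
rewrite !exprfctE /mono /GRing.scale /=.
by set A := lform ca (u - V); set B := lform cb (u - V); clearbody A B; ring.
Qed.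

Lemma pd_mono p q i : let e := delta_mx 0 i in
  pd i (mono p q) =
  fun u => (p%:R * lform ca e) * mono p.-1 q u + (q%:R * lform cb e) * mono p q.-1 u.
Proof.
move=> e; apply/funext => u.
exact: (@derive_val _ _ _ _ _ _ _ (is_derive_mono p q u e)).
Qed.

Lemma is_Cm_mono m p q : is_Cm m (mono p q).
Proof.
elim: m p q => [|m IHm] p q.
  split=> // u; have cX c n :
      {for u, continuous (fun y : 'rV[R]_2 => lform c (y - V) ^+ n)}.
    exact: cvg_comp (@continuous_lform c V u) (@exprn_continuous R n _).
  exact: cvgM (cX ca p) (cX cb q).
split=> [|i]; first exact: is_Cm_continuous (IHm p q).
split=> [u|].
  exact: (@ex_derive _ _ _ _ _ _ _ (is_derive_mono p q u (delta_mx 0 i))).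
by rewrite pd_mono; exact: is_Cm_comb.
Qed.

Lemma dird_mono p q v :
  dird v (mono p q) =
  fun u => (p%:R * lform ca v) * mono p.-1 q u + (q%:R * lform cb v) * mono p q.-1 u.
Proof.
rewrite dirdE !pd_mono; apply/funext => u.
rewrite /lform !mxE /=; move: (mono p.-1 q u) (mono p q.-1 u) => s t.
ring.
Qed.

(** Each derivative turns a monomial of degree l into p + q = l monomials of
    degree l - 1, counted with multiplicity, and produces one value of a linear
    form on a direction. The falling factorial vanishes when the order exceeds
    the degree, so the truncated subtraction in the exponent is harmless. *)
Lemma norm_dirds_mono_le (K M : R) ws x p q : 0 <= K ->
  (forall w, w \in ws -> `|lform ca w| <= K /\ `|lform cb w| <= K) ->
  `|lform ca (x - V)| <= M -> `|lform cb (x - V)| <= M ->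
  `|dirds ws (mono p q) x|
    <= ((p + q) ^_ size ws)%:R * K ^+ size ws * M ^+ (p + q - size ws).
Proof.
move=> K_ge0 wsK aM bM; elim/last_ind: ws p q wsK => [|ws v IH] p q wsK.
  rewrite ffactn0 subn0 expr0 !mul1r /= normrM !normrX exprD.
  by rewrite ler_pM ?exprn_ge0 // lerXn2r ?nnegrE // (le_trans _ aM).
have [av bv] : `|lform ca v| <= K /\ `|lform cb v| <= K.
  by apply: wsK; rewrite mem_rcons mem_head.
have {}wsK w : w \in ws -> `|lform ca w| <= K /\ `|lform cb w| <= K.
  by move=> w_in; apply: wsK; rewrite mem_rcons inE w_in orbT.
rewrite size_rcons /dirds foldr_rcons -!/(dirds _ _) dird_mono.
rewrite dirds_comb; try exact: is_Cm_mono.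
set n := size ws in IH *; pose s := (p + q)%N.
pose Z := K * ((s.-1 ^_ n)%:R * K ^+ n * M ^+ (s.-1 - n)).
have IHp : `|p%:R * lform ca v * dirds ws (mono p.-1 q) x| <= p%:R * Z.
  case: p @s @Z => [|p] s Z; first by rewrite !mul0r normr0.
  rewrite -mulrA normrM normr_nat ler_wpM2l // normrM ler_pM //.
  exact: IH.
have IHq : `|q%:R * lform cb v * dirds ws (mono p q.-1) x| <= q%:R * Z.
  case: q @s @Z {IHp} => [|q] s Z; first by rewrite !mul0r normr0.
  rewrite -mulrA normrM normr_nat ler_wpM2l // normrM ler_pM //.
  by rewrite /Z /s addnS; exact: IH.
rewrite (le_trans (ler_normD _ _)) // (le_trans (lerD IHp IHq)) //.
rewrite -mulrDl -natrD -/s /Z; clear IHp IHq Z.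
case: s => [|s]; first by rewrite ffact0n !mul0r.
by rewrite ffactSS natrM subSS exprS /= le_eqVlt; apply/orP; left; apply/eqP; ring.
Qed.

End Monomials.
End LinearForms.

(** * Barycentric coordinates as linear forms *)

Section Areas.
Context {R : realType}.
Implicit Types (P Q T V x w : 'rV[R]_2).

Lemma det_mx2 (A : 'M[R]_2) : \det A = A 0 0 * A 1 1 - A 0 1 * A 1 0.
Proof.
rewrite (expand_det_row _ ord0) !big_ord_recl big_ord0 /cofactor !det_mx11.
rewrite !mxE /= expr0 expr1 mul1r mulN1r mulrN addr0.
by congr (A _ _ * A _ _ - A _ _ * A _ _); exact/val_inj.
Qed.

Lemma areaE P Q T : area P Q T =
  (Q 0 0 - P 0 0) * (T 0 1 - P 0 1) - (Q 0 1 - P 0 1) * (T 0 0 - P 0 0).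
Proof.
rewrite /area (expand_det_row _ ord0) !big_ord_recl big_ord0 /cofactor.
by rewrite !det_mx2 !mxE /=; ring.
Qed.

(** The linear form of coefficient vector [perp s w] is s times the cross product
    with w. *)
Definition perp (s : R) w : 'rV[R]_2 := s *: \row_j [:: w 0 1; - w 0 0]`_j.

Lemma norm_perp_le (s L : R) w i : enorm w <= L -> `|perp s w 0 i| <= `|s| * L.
Proof.
move=> wL; rewrite !mxE normrM ler_wpM2l // (le_trans _ wL) //.
by case: i => [[|[|//]] ?] /=; rewrite ?normrN norm_coord_le.
Qed.

Lemma bary2E V1 V2 V3 x :
  bary2 V1 V2 V3 x = lform (perp (area V1 V2 V3)^-1 (V3 - V1)) (x - V1).
Proof.
rewrite /bary2 [area V1 x V3]areaE /lform !mxE /=; ring.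
Qed.

Lemma bary23E V1 V2 V3 x :
  bary2 V1 V2 V3 x + bary3 V1 V2 V3 x =
  lform (perp (area V1 V2 V3)^-1 (V3 - V2)) (x - V1).
Proof.
rewrite /bary2 /bary3 [area V1 x V3]areaE [area V1 V2 x]areaE /lform !mxE /=; ring.
Qed.
End Areas.

(** * Bounds on derivatives of polynomials in two linear forms *)

Section PolynomialBounds.
Context {R : realType}.
Variables (ws : seq 'rV[R]_2) (x : 'rV[R]_2) (T : R).
Implicit Types (g h : 'rV[R]_2 -> R).

(** A bound at the single point [x], for one list of directions, together with
    the smoothness that makes the bound stable under linear combinations. *)
Definition dirds_le g (c : R) :=
  (forall k, is_Cm k g) /\ `|dirds ws g x| <= c * T.

Lemma dirds_leD g h (c d : R) :
  dirds_le g c -> dirds_le h d -> dirds_le (fun u => g u + h u) (c + d).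
Proof.
move=> [Cg gc] [Ch hd].
have -> : (fun u => g u + h u) = (fun u => 1 * g u + 1 * h u).
  by apply/funext => u; rewrite !mul1r.
split=> [k|]; first exact: is_Cm_comb.
rewrite dirds_comb // !mul1r mulrDl (le_trans (ler_normD _ _)) //.
exact: lerD.
Qed.

Lemma dirds_leZ (a b : R) h (d : R) : `|a| <= b ->
  dirds_le h d -> dirds_le (fun u => a * h u) (b * d).
Proof.
move=> ab [Ch hd].
have -> : (fun u => a * h u) = (fun u => a * h u + 0 * h u).
  by apply/funext => u; rewrite mul0r addr0.
split=> [k|]; first exact: is_Cm_comb.
by rewrite dirds_comb // mul0r addr0 normrM -mulrA ler_pM.
Qed.

Lemma dirds_le_sum (I : Type) (s : seq I) (P : pred I)
    (F : I -> 'rV[R]_2 -> R) (c : I -> R) :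
  (forall i, P i -> dirds_le (F i) (c i)) ->
  dirds_le (fun u => \sum_(i <- s | P i) F i u) (\sum_(i <- s | P i) c i).
Proof.
move=> Fc; elim: s => [|i s IH].
  (* The zero function, written as a combination of smooth functions. *)
  have -> : (fun u => \sum_(i <- [::] | P i) F i u) =
      (fun u => 0 * mono 0 0 0 0 0 u + 0 * mono 0 0 0 0 0 u).
    by apply/funext => u; rewrite big_nil !mul0r addr0.
  split=> [k|]; first by apply: is_Cm_comb; exact: is_Cm_mono.
  rewrite dirds_comb; try exact: is_Cm_mono.
  by rewrite big_nil !mul0r addr0 normr0.
have [Pi|nPi] := boolP (P i).
  have -> : (fun u => \sum_(j <- i :: s | P j) F j u) =
            (fun u => F i u + \sum_(j <- s | P j) F j u).
    by apply/funext => u; rewrite big_cons Pi.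
  by rewrite big_cons Pi; apply: dirds_leD => //; exact: Fc.
have -> : (fun u => \sum_(j <- i :: s | P j) F j u) =
          (fun u => \sum_(j <- s | P j) F j u).
  by apply/funext => u; rewrite big_cons (negbTE nPi).
by rewrite big_cons (negbTE nPi).
Qed.

End PolynomialBounds.

(** * The Bernoulli factors as polynomials *)

Section Bernoulli.
Context {R : realType}.

Lemma size_bernS n : (size (@bernS R n) <= n.+1)%N.
Proof.
rewrite (leq_trans (size_polyD _ _)) // geq_max size_bernoulli size_polyN.
by rewrite (leq_trans (size_polyC_leq1 _)).
Qed.

Lemma size_bernS_divX n : (size (@bernS R n %/ 'X)%R <= n)%N.
Proof.
by rewrite size_divp ?polyX_eq0 // size_polyX leq_subLR add1n size_bernS.
Qed.

Lemma bernS_divX_mulX n (s : R) : (bernS n %/ 'X).[s] * s = (bernS n).[s].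
Proof.
rewrite -[s in _ * s]hornerX -hornerM divpK // -['X]subr0 -polyC0 dvdp_XsubCl.
by rewrite /root /bernS hornerD hornerN hornerC subrr.
Qed.

Lemma bernS_expand n (s : R) :
  (bernS n).[s] = \sum_(k < n) (bernS n %/ 'X)`_k * s ^+ k.+1.
Proof.
rewrite -bernS_divX_mulX (horner_coef_wide _ (size_bernS_divX n)) mulr_suml.
by apply: eq_bigr => k _; rewrite exprSr mulrA.
Qed.

(** All exponents of s are natural numbers and the degree is i + q <= i + j - 1. *)
Lemma bernSS_expand i j (a s : R) : bernSS i j a s =
  \sum_(k < i.+1) \sum_(q < j)
    ((bernS i)`_k * (bernS j %/ 'X)`_q) * (a ^+ k * s ^+ (i - k + q)).
Proof.
rewrite /bernSS (horner_coef_wide _ (size_bernS_divX j)) mulr_suml.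
apply: eq_bigr => k _; rewrite mulr_sumr; apply: eq_bigr => q _.
by rewrite exprD; ring.
Qed.
End Bernoulli.

(** * The estimate *)

Section Assembly.
Context {R : realType}.
Implicit Types (c u v V x w : 'rV[R]_2).

Lemma dird_delta_mx i (g : 'rV[R]_2 -> R) : dird (delta_mx 0 i) g = pd i g.
Proof.
rewrite dirdE; apply/funext => u; rewrite !mxE.
by have [->|->] := ord2_cases i; rewrite /= ?mul1r ?mul0r ?addr0 ?add0r.
Qed.

Lemma partial_dirds a b (g : 'rV[R]_2 -> R) :
  partial a b g = dirds (nseq a (delta_mx 0 0) ++ nseq b (delta_mx 0 1)) g.
Proof.
rewrite dirds_cat -!iter_dird /partial.
have E i n h : iter n (dird (delta_mx 0 i)) h = iter n (pd i) h :> ('rV[R]_2 -> R).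
  by elim: n => //= n ->; exact: dird_delta_mx.
by rewrite !E.
Qed.

(** The sum over l of the estimate, without the factor r^(m+1) that comes from the
    segment integrals. *)
Definition powsum (m n : nat) (K rho : R) : R :=
  \sum_(maxn 1 n <= l < m.+1) K ^+ l * rho ^+ (l - n).

Lemma powsum_term_le m n (K rho : R) l : 0 <= K -> 0 <= rho ->
  (0 < l <= m)%N -> (n <= l)%N -> K ^+ l * rho ^+ (l - n) <= powsum m n K rho.
Proof.
move=> K_ge0 rho_ge0 /andP[l_gt0 l_le] n_le; rewrite /powsum.
rewrite (bigD1_seq l) ?iota_uniq ?mem_index_iota //=; last first.
  by rewrite geq_max l_gt0 n_le ltnS.
by rewrite lerDl sumr_ge0 // => i _; rewrite mulr_ge0 ?exprn_ge0.
Qed.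

Lemma powsum_ge0 m n (K rho : R) : 0 <= K -> 0 <= rho -> 0 <= powsum m n K rho.
Proof. by move=> *; rewrite sumr_ge0 // => i _; rewrite mulr_ge0 ?exprn_ge0. Qed.

(** The bound on monomials made uniform in the degree: the falling factorial is at
    most m!, and 2^l <= 2^m. *)
Lemma dirds_le_mono m (ws : seq 'rV[R]_2) x (ca cb V : 'rV[R]_2) (K : R) p q :
  0 <= K ->
  (forall w, w \in ws -> forall i, `|w 0 i| <= 1) ->
  (forall i, `|ca 0 i| <= K) -> (forall i, `|cb 0 i| <= K) ->
  (0 < p + q <= m)%N ->
  dirds_le ws x (m`!%:R * 2 ^+ m * powsum m (size ws) K (enorm (x - V)))
    (mono ca cb V p q) 1.
Proof.
move=> K_ge0 ws1 caK cbK pq.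
split=> [k|]; first exact: is_Cm_mono.
set rho := enorm (x - V).
have rho_ge0 : 0 <= rho by exact: enorm_ge0.
have cx c : (forall i, `|c 0 i| <= K) -> `|lform c (x - V)| <= 2 * K * rho.
  by move=> cK; apply: norm_lform_le => // i; exact: norm_coord_le.
have cw w : w \in ws -> `|lform ca w| <= 2 * K /\ `|lform cb w| <= 2 * K.
  by move=> /ws1 w1; split; rewrite -[2 * K]mulr1; exact: norm_lform_le.
have K2_ge0 : 0 <= 2 * K by rewrite mulr_ge0.
rewrite mul1r (le_trans (norm_dirds_mono_le p q K2_ge0 cw (cx _ caK) (cx _ cbK))) //.
set n := size ws; move: pq; set l := (p + q)%N => pq.
have [n_le|l_lt] := leqP n l; last first.
  by rewrite ffact_small // !mul0r !mulr_ge0 ?powsum_ge0 // exprn_ge0.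
have [_ l_le] := andP pq.
have E : (2 * K) ^+ n * (2 * K * rho) ^+ (l - n) =
    2 ^+ l * (K ^+ l * rho ^+ (l - n)).
  have [d ->] : exists d, l = (n + d)%N by exists (l - n)%N; rewrite subnKC.
  by rewrite addKn !exprD !exprMn; ring.
rewrite -mulrA E mulrA.
rewrite ler_pM ?mulr_ge0 ?exprn_ge0 //; last exact: powsum_term_le.
rewrite ler_pM ?exprn_ge0 //; last by rewrite ler_weXn2l // ler1n.
rewrite ler_nat (leq_trans _ (leq_fact l_le)) //.
by rewrite -(ffact_fact n_le) leq_pmulr // fact_gt0.
Qed.

(** S_j has no constant term, so dividing by 'X only shifts its coefficients: this
    is the l^1 norm of S_j / j!. *)
Definition bernS_norm j : R := (\sum_(k < j) `|(@bernS R j %/ 'X)`_k|) / j`!%:R.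

(** Equal monomials are not collected, so this is an upper bound for the l^1 norm
    of [bernSS i j] divided by i! j!. *)
Definition bernSS_norm i j : R :=
  (\sum_(k < i.+1) \sum_(q < j) `|(@bernS R i)`_k * (@bernS R j %/ 'X)`_q|)
    / (i`!%:R * j`!%:R).

Section Bound.
Variables (m : nat) (ws : seq 'rV[R]_2) (x : 'rV[R]_2) (T : R).
Variables (ca cb V : 'rV[R]_2).
Hypothesis monoT : forall p q, (0 < p + q <= m)%N ->
  dirds_le ws x T (mono ca cb V p q) 1.

Lemma dirds_le_bernS j : (j <= m)%N ->
  dirds_le ws x T (fun u => (bernS j).[lform cb (u - V)] / j`!%:R) (bernS_norm j).
Proof.
move=> le_jm.
have -> : (fun u => (bernS j).[lform cb (u - V)] / j`!%:R) =
    (fun u => j`!%:R^-1 * \sum_(k < j) (bernS j %/ 'X)`_k * mono ca cb V 0 k.+1 u).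
  apply/funext => u; rewrite bernS_expand mulrC; congr (_ * _).
  by apply: eq_bigr => k _; rewrite /mono expr0 mul1r.
rewrite /bernS_norm mulrC; apply: dirds_leZ; first by rewrite ger0_norm // invr_ge0.
apply: dirds_le_sum => k _; rewrite -[`|_|]mulr1; apply: dirds_leZ => //.
by apply: monoT; rewrite add0n /= (leq_trans (ltn_ord k)).
Qed.

Lemma dirds_le_bernSS i j : (0 < i)%N -> (i + j <= m.+1)%N ->
  dirds_le ws x T
    (fun u => bernSS i j (lform ca (u - V)) (lform cb (u - V)) / (i`!%:R * j`!%:R))
    (bernSS_norm i j).
Proof.
move=> i_gt0 le_m.
have -> : (fun u => bernSS i j (lform ca (u - V)) (lform cb (u - V))
                      / (i`!%:R * j`!%:R)) =
    (fun u => (i`!%:R * j`!%:R)^-1 * \sum_(k < i.+1) \sum_(q < j)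
       (bernS i)`_k * (bernS j %/ 'X)`_q * mono ca cb V k (i - k + q) u).
  by apply/funext => u; rewrite bernSS_expand mulrC.
rewrite /bernSS_norm [X in dirds_le _ _ _ _ X]mulrC; apply: dirds_leZ.
  by rewrite ger0_norm // invr_ge0 mulr_ge0.
apply: dirds_le_sum => k _; apply: dirds_le_sum => q _.
rewrite -[`|_|]mulr1; apply: dirds_leZ => //.
apply: monoT; rewrite addnA subnKC; last by rewrite -ltnS.
by have := ltn_ord q; lia.
Qed.
End Bound.

(** Termwise product of the bound on the segment integrals and of the bound on the
    monomials; the two integrals in each term of the double sum account for the
    factor 2. *)
Lemma norm_partial_delta_le m a b (D : set 'rV[R]_2) V1 V2 V3 f x (r : R) :
  convex_set D -> D V1 -> D V2 -> D V3 -> is_Cm1D m D f ->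
  enorm (V1 - V2) <= r -> enorm (V1 - V3) <= r -> enorm (V2 - V3) <= r ->
  `|partial a b (delta m V1 V2 V3 D f) x| <=
  (\sum_(1 <= j < m.+1) bernS_norm j
   + \sum_(1 <= i < m.+1) \sum_(1 <= j < (m - i + 1).+1) 2 * bernSS_norm i j)
  * (seminorm_m1 m D f * ((2 * r) ^+ m * r)
     * (m`!%:R * 2 ^+ m
        * powsum m (a + b) (`|(area V1 V2 V3)^-1| * r) (enorm (x - V1)))).
Proof.
move=> cvD DV1 DV2 DV3 fC r12 r13 r23.
have r_ge0 : 0 <= r := le_trans (enorm_ge0 _) r12.
have r21 : enorm (V2 - V1) <= r by rewrite -opprB enormN.
have r31 : enorm (V3 - V1) <= r by rewrite -opprB enormN.
have r32 : enorm (V3 - V2) <= r by rewrite -opprB enormN.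
set B := seminorm_m1 m D f * ((2 * r) ^+ m * r).
have B_ge0 : 0 <= B by rewrite !mulr_ge0 ?exprn_ge0 ?mulr_ge0 ?seminorm_m1_ge0.
set K := `|_| * r.
have K_ge0 : 0 <= K by rewrite mulr_ge0.
rewrite partial_dirds; set ws := _ ++ _.
have size_ws : size ws = (a + b)%N by rewrite size_cat !size_nseq.
rewrite -size_ws; set T := m`!%:R * _ * _.
have ws1 w : w \in ws -> forall i, `|w 0 i| <= 1.
  rewrite mem_cat !mem_nseq => /orP[] /andP[_ /eqP ->] i; rewrite mxE;
  by case: (_ && _); rewrite ?normr1 ?normr0.
pose s := (area V1 V2 V3)^-1.
have caK i : `|perp s (V3 - V1) 0 i| <= K by exact: norm_perp_le.
have cbK i : `|perp s (V3 - V2) 0 i| <= K by exact: norm_perp_le.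
have monoT p q : (0 < p + q <= m)%N ->
    dirds_le ws x T (mono (perp s (V3 - V1)) (perp s (V3 - V2)) V1 p q) 1.
  exact: dirds_le_mono.
rewrite mulrA [_ * B]mulrC; set c := B * _.
suff [_ //] : dirds_le ws x T (delta m V1 V2 V3 D f) c.
have -> : delta m V1 V2 V3 D f = (fun u =>
    \sum_(1 <= j < m.+1)
     seg_int V1 V3 (m + 1 - j) (dird2 (V2 - V1) (V3 - V1) 0 (j - 1) (ext m D f))
     * ((bernS j).[lform (perp s (V3 - V2)) (u - V1)] / j`!%:R)
  + \sum_(1 <= i < m.+1) \sum_(1 <= j < (m - i + 1).+1)
     ((-1) ^+ (i + j)
        * seg_int V1 V2 (m + 2 - (i + j))
            (dird2 (V1 - V2) (V3 - V2) (j - 1) (i - 1) (ext m D f))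
      + (-1) ^+ j
        * seg_int V1 V3 (m + 2 - (i + j))
            (dird2 (V1 - V3) (V2 - V3) (j - 1) (i - 1) (ext m D f)))
     * (bernSS i j (lform (perp s (V3 - V1)) (u - V1))
          (lform (perp s (V3 - V2)) (u - V1)) / (i`!%:R * j`!%:R))).
  by apply/funext => u; rewrite /delta bary23E bary2E.
have segB Q k k1 k2 v w :
    D Q -> enorm (Q - V1) <= r -> enorm v <= r -> enorm w <= r ->
    (k + (k1 + k2))%N = m -> `|seg_int V1 Q k (dird2 v w k1 k2 (ext m D f))| <= B.
  move=> DQ Qr vr wr Em.
  rewrite /dird2 iter_dird iter_dird -dirds_cat; apply: norm_seg_int_le => //.
    by rewrite size_cat !size_nseq.
  by move=> y; rewrite mem_cat !mem_nseq => /orP[] /andP[_ /eqP ->].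
rewrite /c mulrDr; apply: dirds_leD.
  rewrite mulr_sumr [X in dirds_le _ _ _ _ X]big_seq.
  under eq_fun do rewrite big_seq.
  apply: dirds_le_sum => j; rewrite mem_index_iota ltnS => /andP[j_gt0 j_le].
  apply: dirds_leZ; last exact (dirds_le_bernS monoT j_le).
  by apply: segB => //; lia.
rewrite mulr_sumr [X in dirds_le _ _ _ _ X]big_seq.
under eq_fun do rewrite big_seq.
apply: dirds_le_sum => i; rewrite mem_index_iota ltnS => /andP[i_gt0 i_le].
rewrite mulr_sumr [X in dirds_le _ _ _ _ X]big_seq.
under eq_fun do rewrite big_seq.
apply: dirds_le_sum => j; rewrite mem_index_iota ltnS => /andP[j_gt0 j_le].
rewrite [X in dirds_le _ _ _ _ X]mulrA; apply: dirds_leZ; last first.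
  by apply: (dirds_le_bernSS monoT) => //; lia.
have sgB n (z : R) : `|z| <= B -> `|(-1) ^+ n * z| <= B.
  by rewrite normrM normrX normrN1 expr1n mul1r.
have -> : B * 2 = B + B by rewrite mulr_natr mulr2n.
apply: le_trans (ler_normD _ _) _; apply: lerD; apply: sgB; apply: segB => //; lia.
Qed.

End Assembly.

Theorem theorem2p5 (R : realType) (m a b : nat)
    (hm : (1 <= m)%N) (hab : (a + b <= m)%N) :
  exists C : R,
    forall (D : set 'rV[R]_2) (V1 V2 V3 : 'rV[R]_2) (f : 'rV[R]_2 -> R),
      compact D -> convex_set D ->
      D V1 -> D V2 -> D V3 -> area V1 V2 V3 != 0 ->
      is_Cm1D m D f ->
      forall x : 'rV[R]_2, D x ->
        let r := Num.max (enorm (V1 - V2))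
                   (Num.max (enorm (V1 - V3)) (enorm (V2 - V3))) in
        let S := `|area V1 V2 V3|^-1 in
        `|partial a b (delta m V1 V2 V3 D f) x| <=
        seminorm_m1 m D f * C *
        \sum_(maxn 1 (a + b) <= l < m.+1)
          r ^+ (m + 1 - l) * (r ^+ 2 * S) ^+ l * enorm (x - V1) ^+ (l - (a + b)).
Proof.
pose c : R := \sum_(1 <= j < m.+1) bernS_norm j
  + \sum_(1 <= i < m.+1) \sum_(1 <= j < (m - i + 1).+1) 2 * bernSS_norm i j.
exists (c * (2 ^+ m * (m`!%:R * 2 ^+ m))).
move=> D V1 V2 V3 f _ cvD DV1 DV2 DV3 _ fC x _.
set r := Num.max (enorm (V1 - V2)) _; set S := `|area V1 V2 V3|^-1; cbv zeta.
have r12 : enorm (V1 - V2) <= r by rewrite le_max lexx.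
have r13 : enorm (V1 - V3) <= r by rewrite !le_max lexx orbT.
have r23 : enorm (V2 - V3) <= r by rewrite !le_max lexx !orbT.
apply: le_trans (norm_partial_delta_le a b x cvD DV1 DV2 DV3 fC r12 r13 r23) _.
rewrite -/c normfV -/S.
have -> : \sum_(maxn 1 (a + b) <= l < m.+1)
    r ^+ (m + 1 - l) * (r ^+ 2 * S) ^+ l * enorm (x - V1) ^+ (l - (a + b))
  = r ^+ m.+1 * powsum m (a + b) (S * r) (enorm (x - V1)).
  rewrite /powsum mulr_sumr; apply: eq_big_nat => l /andP[_ l_le].
  rewrite mulrA; congr (_ * _).
  have -> : m.+1 = (m + 1 - l + l)%N by lia.
  rewrite exprD -mulrA; congr (_ * _).
  by rewrite -exprMn; congr (_ ^+ _); ring.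
move: (powsum _ _ _ _) (seminorm_m1 m D f) => P N.
by rewrite exprMn exprSr le_eqVlt; apply/orP; left; apply/eqP; ring.
Qed.
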